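(* Let $k$ be a positive integer and consider the $k$-th order system of two rational difference equations $$x_n=\frac{\alpha+\sum^{k}_{i=1}\beta_{i}x_{n-i} + \sum^{k}_{i=1}\gamma_{i}y_{n-i}}{A+\sum^{k}_{j=1}B_{j}x_{n-j} + \sum^{k}_{j=1}C_{j}y_{n-j}},\qquad y_n=\frac{p+\sum^{k}_{i=1}\delta_{i}x_{n-i} + \sum^{k}_{i=1}\epsilon_{i}y_{n-i}}{q+\sum^{k}_{j=1}D_{j}x_{n-j} + \sum^{k}_{j=1}E_{j}y_{n-j}},\qquad n\in\mathbb{N},$$ with non-negative real parameters and non-negative initial conditions. Assume that $A>0$, $q>0$, $I_\gamma\subseteq I_C$, and that there exists a positive integer $\eta$ such that for every sequence $\{c_m\}_{m=1}^\infty$ with $c_m\in I_\beta$ for all $m\ge 1$ there exist positive integers $N_1,N_2\le\eta$ such that $\sum_{m=N_1}^{N_2}c_m\in I_B$. Assume further that there exists a positive integer $\eta_2$ such that for every sequence $\{d_m\}_{m=1}^\infty$ with $d_m\in I_\epsilon$ for all $m\ge 1$ there exist positive integers $N_3,N_4\le\eta_2$ such that $\sum_{m=N_3}^{N_4}d_m\in I_E$. Then there exist $M>0$ and $N\in\mathbb{N}$ such that every solution (from any non-negative initial conditions) satisfies $x_n\le M$ and $y_n\le M$ for all $n>N$.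
   Context: $\mathbb{N}=\{1,2,\dots\}$. Initial conditions are $x_{1-k},\dots,x_0,y_{1-k},\dots,y_0\ge 0$; a solution is a pair of sequences generated by the system from non-negative initial conditions for which all denominators are positive for every $n\in\mathbb{N}$. Index sets in $\{1,\dots,k\}$: $I_\beta=\{i:\beta_i>0\}$, $I_\gamma=\{i:\gamma_i>0\}$, $I_\epsilon=\{i:\epsilon_i>0\}$, $I_B=\{j:B_j>0\}$, $I_C=\{j:C_j>0\}$, $I_E=\{j:E_j>0\}$. A sum whose lower limit exceeds its upper limit is empty and equals $0$. *)

(* Defs.v *)
From mathcomp Require Import all_boot all_order all_algebra.
From mathcomp Require Import reals.

Set Implicit Arguments.
Unset Strict Implicit.
Unset Printing Implicit Defensive.

Import Order.TTheory GRing.Theory Num.Theory.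
Local Open Scope ring_scope.

(* Coefficient families are functions on [nat], used only at the indices
   1, ..., k.  Solutions are functions on [int], used only at the indices
   n >= 1 - k; the values at 1 - k, ..., 0 are the initial conditions. *)

Definition affine (R : realType) (k : nat) (a : R) (b c : nat -> R)
    (x y : int -> R) (n : nat) : R :=
  a + \sum_(1 <= i < k.+1) b i * x (n%:Z - i%:Z)
    + \sum_(1 <= i < k.+1) c i * y (n%:Z - i%:Z).

Definition index_set (R : realType) (k : nat) (b : nat -> R) : {pred nat} :=
  [pred i : nat | (1 <= i <= k)%N && (0 < b i)].

Definition nonneg_coefs (R : realType) (k : nat) (b : nat -> R) : Prop :=
  forall i : nat, (1 <= i <= k)%N -> 0 <= b i.

Definition nonneg_init (R : realType) (k : nat) (u : int -> R) : Prop :=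
  forall m : int, 1 - k%:Z <= m <= 0 -> 0 <= u m.

Definition is_solution (R : realType) (k : nat)
    (alpha : R) (beta gamma : nat -> R) (A : R) (B C : nat -> R)
    (p : R) (delta epsilon : nat -> R) (q : R) (D E : nat -> R)
    (x y : int -> R) : Prop :=
  [/\ nonneg_init k x, nonneg_init k y &
    forall n : nat, (1 <= n)%N ->
      [/\ 0 < affine k A B C x y n,
          0 < affine k q D E x y n,
          x n%:Z = affine k alpha beta gamma x y n / affine k A B C x y n &
          y n%:Z = affine k p delta epsilon x y n / affine k q D E x y n]].

(* Every infinite sequence in [I] has, within its first [eta] terms, a block
   of consecutive terms whose sum lies in [J]; the sum is 0 when N2 < N1. *)
Definition block_sums_hit (I J : {pred nat}) (eta : nat) : Prop :=
  forall c : nat -> nat, (forall m : nat, (1 <= m)%N -> c m \in I) ->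
    exists N1 N2 : nat,
      [/\ (1 <= N1 <= eta)%N, (1 <= N2 <= eta)%N &
          (\sum_(N1 <= m < N2.+1) c m)%N \in J].

(* Main.v *)
Require Import Defs.
From mathcomp Require Import all_boot all_order all_algebra.
From mathcomp Require Import reals.
From mathcomp Require Import zify ring lra.

(* Since gamma_i > 0 forces C_i > 0, each term gamma_i y_{n-i} of the first
   numerator is absorbed by the denominator, leaving
     x_n <= K + (sum_i beta_i x_{n-i}) / (A + sum_j B_j x_{n-j}).
   Starting from n, step back repeatedly to the index n - c with c in I_beta
   maximising x_{n-c}; each step multiplies by at most (sum_i beta_i) / A, up
   to an additive constant. The steps form a sequence in I_beta, so within eta
   steps some block of them adds up to an element j of I_B. At the start s of
   that block the denominator contains B_j x_{s-j}, and s - j is the end of the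
   block, so the factor x_{s-j} cancels and x_n is bounded by constants. Once x
   is bounded, the delta-terms of the second equation are bounded too and the
   same argument applies to y. *)

Import Order.TTheory GRing.Theory Num.Theory.
Local Open Scope ring_scope.

Lemma in_index_set (R : realType) (k : nat) (b : nat -> R) (i : nat) :
  (i \in index_set k b) = (1 <= i <= k)%N && (0 < b i).
Proof. by []. Qed.

Lemma sum_index_ge0 (R : realType) (k : nat) (F : nat -> R) :
  (forall i : nat, (1 <= i <= k)%N -> 0 <= F i) ->
  0 <= \sum_(1 <= i < k.+1) F i.
Proof. by move=> F0; rewrite big_nat; apply: sumr_ge0 => i; apply: F0. Qed.

Lemma le_term_sum_index (R : realType) (k : nat) (F : nat -> R) (j : nat) :
  (forall i : nat, (1 <= i <= k)%N -> 0 <= F i) -> (1 <= j <= k)%N ->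
  F j <= \sum_(1 <= i < k.+1) F i.
Proof.
move=> F0 hj.
rewrite (bigD1_seq j) ?iota_uniq ?mem_index_iota //=.
by rewrite lerDl big_seq_cond sumr_ge0 // => i; rewrite mem_index_iota => /andP[/F0].
Qed.

Lemma ler_sum_index (R : realType) (k : nat) (F G : nat -> R) :
  (forall i : nat, (1 <= i <= k)%N -> F i <= G i) ->
  \sum_(1 <= i < k.+1) F i <= \sum_(1 <= i < k.+1) G i.
Proof. by move=> FG; apply: ler_sum_nat => i; apply: FG. Qed.

(** Each step back from [q] costs a factor and an additive [K]. The factor is taken as [1 + r]
    rather than [r]: its powers are at least 1 and grow with the exponent, so one bound serves all
    [q - p <= N]. *)
Lemma iterated_bound (R : realType) (K r : R) (v : nat -> R) (N p q : nat) :
  0 <= K -> 0 <= r -> (forall m, 0 <= v m) ->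
  (forall m, (m < N)%N -> v m <= K + r * v m.+1) -> (p <= q <= N)%N ->
  v p <= (1 + r) ^+ N * (N%:R * K + v q).
Proof.
move=> K0 r0 v0 step /andP[pq qN].
have W1 : 1 <= 1 + r by lra.
have aux l : (l <= q)%N -> v (q - l)%N <= (1 + r) ^+ l * (l%:R * K + v q).
  elim: l => [|l IH] lq; first by rewrite subn0 expr0 mul1r mul0r add0r.
  have /IH {}IH : (l <= q)%N by lia.
  have /step : (q - l.+1 < N)%N by lia.
  have -> : (q - l.+1).+1 = (q - l)%N by lia.
  move=> h; apply: (le_trans h); rewrite exprS -mulrA -natr1.
  set w := (1 + r) ^+ l in IH *.
  have w1 : 1 <= w by rewrite exprn_ege1.
  have := v0 (q - l)%N; move: IH; set s := v _ => IH s0.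
  have -> : (1 + r) * (w * ((l%:R + 1) * K + v q)) =
    (1 + r) * (w * (l%:R * K + v q)) + (1 + r) * w * K by ring.
  have h1 : K <= (1 + r) * w * K by rewrite ler_peMl // mulr_ege1.
  have h2 : (1 + r) * s <= (1 + r) * (w * (l%:R * K + v q)) by rewrite ler_wpM2l //; lra.
  nra.
have lN : (q - p <= N)%N by lia.
have := aux (q - p)%N ltac:(lia).
rewrite subKn // => /le_trans; apply; apply: ler_pM.
- by rewrite exprn_ge0 //; lra.
- by rewrite addr_ge0 // mulr_ge0.
- by rewrite ler_weXn2l.
- by rewrite lerD2r ler_wpM2r // ler_nat.
Qed.

(** [M] is chosen before [u] and [n0], which makes the final bound uniform over solutions. The free
    start [n0] lets the lemma serve both equations: for [y] the recursion holds only once [x] is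
    bounded. *)
Lemma recursion_bound {R : realType} {k : nat} {K a : R} {b B : nat -> R}
    {eta : nat} :
  0 <= K -> 0 < a -> nonneg_coefs k b -> nonneg_coefs k B ->
  block_sums_hit (index_set k b) (index_set k B) eta ->
  exists2 M : R, 0 <= M &
    forall (u : int -> R) (n0 : int),
      (forall t : int, n0 - k%:Z <= t -> 0 <= u t) ->
      (forall t : int, n0 <= t ->
        u t <= K + (\sum_(1 <= i < k.+1) b i * u (t - i%:Z)) /
                   (a + \sum_(1 <= j < k.+1) B j * u (t - j%:Z))) ->
      forall t : int, n0 + (k * eta)%N%:Z <= t -> u t <= M.
Proof.
move=> K0 a0 b0 B0 hit.
pose S := \sum_(1 <= i < k.+1) b i.
have S0 : 0 <= S by apply: sum_index_ge0.
pose r := S / a; have r0 : 0 <= r by rewrite divr_ge0 // ltW.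
pose W := (1 + r) ^+ eta.
have W0 : 0 <= W by rewrite exprn_ge0 //; lra.
(* Dominates every [(B j)^-1] with [0 < B j]; vanishing [B j] contribute [0^-1 = 0]. *)
pose invB := \sum_(1 <= j < k.+1) (B j)^-1.
have invB0 : 0 <= invB by apply: sum_index_ge0 => j /B0; rewrite invr_ge0.
(* [Q] will bound the value at the start of the block whose lags sum to an element of the index set
   of [B]. *)
pose Q := K + r * (W * (eta%:R * K)) + S * W * invB.
have eK0 : 0 <= eta%:R * K by rewrite mulr_ge0.
have Q0 : 0 <= Q by rewrite /Q !addr_ge0 ?(mulr_ge0 r0) ?mulr_ge0 // mulr_ge0.
(* The summand [K] alone covers the case where no [b i] is positive, in which there is no lag to
   follow. *)
exists (K + W * (eta%:R * K + Q)) => [|u n0 u0 rec t ht].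
  by rewrite addr_ge0 // mulr_ge0 // addr_ge0.
have [/existsP[i0 Pi0]|/existsPn noI] :=
  boolP [exists i : 'I_k.+1, (i : nat) \in index_set k b]; last first.
  apply: (le_trans (rec t _)); first by clear -ht; lia.
  rewrite big_nat big1 ?mul0r ?addr0 => [|i hi].
    by rewrite lerDl mulr_ge0 // addr_ge0.
  have hk : (i < k.+1)%N by clear -hi; lia.
  have := noI (Ordinal hk); rewrite in_index_set /= [(0 < i)%N && _]hi /=.
  have := b0 i hi.
  by rewrite le_eqVlt => /orP[/eqP<-|->//]; rewrite mul0r.
pose f (s : int) : nat :=
  [arg max_(i > i0 | (i : nat) \in index_set k b) u (s - (i : nat)%:Z)]%O.
have fP s : f s \in index_set k b.
  by rewrite /f; case: Order.TotalTheory.arg_maxP.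
have fmax s j : j \in index_set k b -> u (s - j%:Z) <= u (s - (f s)%:Z).
  rewrite /f; case: Order.TotalTheory.arg_maxP => //= i _ h hj.
  have hk : (j < k.+1)%N by move: hj; rewrite in_index_set; clear; lia.
  exact: (h (Ordinal hk)).
have fk s : (1 <= f s <= k)%N by have := fP s; rewrite in_index_set => /andP[].
pose den s := a + \sum_(1 <= j < k.+1) B j * u (s - j%:Z).
have Bu0 s j : n0 <= s -> (1 <= j <= k)%N -> 0 <= B j * u (s - j%:Z).
  by move=> hs hj; rewrite mulr_ge0 ?B0 // u0 //; clear -hs hj; lia.
have den_a s : n0 <= s -> a <= den s.
  by move=> hs; rewrite lerDl; apply: sum_index_ge0 => j; apply: Bu0.
have greedy s : n0 <= s -> u s <= K + S * u (s - (f s)%:Z) / den s.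
  move=> hs; apply: (le_trans (rec s hs)); rewrite lerD2l -/(den s).
  rewrite ler_wpM2r //; first by rewrite invr_ge0 (le_trans (ltW a0)) ?den_a.
  rewrite /S mulr_suml; apply: ler_sum_index => i hi.
  have := b0 i hi; rewrite le_eqVlt => /orP[/eqP<-|bi]; first by rewrite !mul0r.
  by rewrite ler_wpM2l ?(ltW bi) // fmax // in_index_set hi.
(* The greedy walk back from [t]: [z m] is the index reached after [m] maximising lags. *)
have [z [zt zS]] : exists z : nat -> int,
    z 0%N = t /\ forall m, z m.+1 = z m - (f (z m))%:Z.
  by exists (fun m => iter m (fun s : int => s - (f s)%:Z) t).
have zk m : t - (k * m)%N%:Z <= z m.
  by elim: m => [|m IH]; [rewrite zt|have := fk (z m); move: IH; rewrite zS]; clear; lia.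
have zn m : (m < eta)%N -> n0 + k%:Z <= z m by move=> hm; have := zk m; clear -hm ht; nia.
(* Each lag is at most [k], so starting at [n0 + k * eta] or later keeps [eta] steps in the range of
   the recursion. *)
have z0 m : (m <= eta)%N -> n0 <= z m by move=> hm; have := zk m; clear -hm ht; nia.
have zsum p l : z p - z (p + l)%N = (\sum_(p <= m < p + l) f (z m))%N%:Z.
  elim: l => [|l IH]; first by rewrite addn0 subrr big_geq.
  by rewrite addnS big_nat_recr ?leq_addr //= PoszD -IH zS; ring.
(* Frozen after [eta] steps, since [u] may be negative before [n0 - k]. *)
pose v m := u (z (minn m eta)).
have v0 m : 0 <= v m.
  by apply: u0; rewrite (le_trans _ (z0 _ (geq_minr _ _))) // gerBl.
have vE m : (m <= eta)%N -> v m = u (z m) by move=> /minn_idPl h; rewrite /v h.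
have vstep m : (m < eta)%N -> v m <= K + S * v m.+1 / den (z m).
  move=> hm; rewrite !vE // ?(ltnW hm) // zS.
  by apply: greedy; apply: z0; apply: ltnW.
have vlin m : (m < eta)%N -> v m <= K + r * v m.+1.
  move=> hm; apply: (le_trans (vstep m hm)); rewrite lerD2l.
  rewrite /r mulrAC ler_wpM2r // ler_wpM2l // lef_pV2 ?posrE ?den_a ?z0 1?ltnW //.
  by rewrite (lt_le_trans a0) // den_a // z0 // ltnW.
(* The hypothesis counts lags from 1 and the walk from 0: lag [m] leads from [z m.-1] to [z m], so
   the block runs from [z N1.-1] to [z N2]. *)
have [N1 [N2 [hN1 hN2 hJ]]] := hit (fun m => f (z m.-1)) (fun m _ => fP _).
move: hJ; rewrite in_index_set => /andP[hj Bj].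
(* An empty block would have sum 0, which is not an admissible index. *)
have N12 : (N1 <= N2)%N.
  by rewrite leqNgt; apply/negP => h; move: hj; rewrite big_geq.
have [hN1e N1le N2le] : [/\ (N1.-1 < eta)%N, (N1 <= N2 <= eta)%N & (N2 <= eta)%N].
  by clear -hN1 hN2 N12; split; lia.
set j := (\sum_(N1 <= m < N2.+1) _)%N in hj Bj.
have zj : z N2 = z N1.-1 - j%:Z.
  have := zsum N1.-1 (N2 - N1.-1)%N.
  have -> : (N1.-1 + (N2 - N1.-1) = N2)%N by rewrite subnKC // (leq_trans (leq_pred _)).
  have -> : (\sum_(N1.-1 <= m < N2) f (z m) = j)%N.
    rewrite /j; case: N1 hN1 {hN2 N12 hj Bj j hN1e N1le} => // N1 _.
    by rewrite big_add1.
  by move=> <-; ring.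
have d0 : 0 < den (z N1.-1) by rewrite (lt_le_trans a0) // den_a // z0 // ltnW.
have dj : v N2 / den (z N1.-1) <= invB.
  have h : B j * v N2 <= den (z N1.-1).
    rewrite vE // zj /den -[leLHS]add0r lerD ?(ltW a0) //.
    apply: (@le_term_sum_index _ _ (fun j => B j * u (z N1.-1 - j%:Z))) => //.
    by move=> i; apply: Bu0; apply: z0; apply: ltnW.
  apply: (@le_trans _ _ (B j)^-1).
    by rewrite ler_pdivrMr // mulrC ler_pdivlMr // mulrC.
  by apply: (@le_term_sum_index _ _ (fun j => (B j)^-1)) => // i /B0; rewrite invr_ge0.
(* The first step of the block keeps its denominator, the remaining ones use the linear bound. In
   the resulting quotient the constant part is divided by at least [a], and [v N2] is absorbed
   through [dj]. *)
have vQ : v N1.-1 <= Q.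
  apply: (le_trans (vstep _ hN1e)).
  have tail : v N1 <= W * (eta%:R * K + v N2) by apply: iterated_bound.
  rewrite /Q -addrA lerD2l prednK; last by case/andP: hN1.
  apply: (@le_trans _ _ (S * (W * (eta%:R * K + v N2)) / den (z N1.-1))).
    by rewrite ler_wpM2r ?invr_ge0 ?(ltW d0) // ler_wpM2l.
  rewrite !mulrDr mulrDl; apply: lerD.
    rewrite /r mulrAC ler_wpM2r ?mulr_ge0 // ler_wpM2l // lef_pV2 ?posrE //.
    by rewrite den_a // z0 // ltnW.
  by rewrite mulrA -mulrA ler_wpM2l // mulr_ge0.
have h0 : v 0%N <= W * (eta%:R * K + v N1.-1) by apply: iterated_bound => //; apply: ltnW.
rewrite vE // zt in h0; apply: (le_trans h0).
by rewrite -[leLHS]add0r lerD // ler_wpM2l // lerD2l.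
Qed.

(** Induction on the index: each new value is a nonnegative numerator over a denominator that is
    positive by the definition of a solution. *)
Lemma solution_ge0 {R : realType} {k : nat}
    {alpha : R} {beta gamma : nat -> R} {A : R} {B C : nat -> R}
    {p : R} {delta epsilon : nat -> R} {q : R} {D E : nat -> R}
    {x y : int -> R} :
  0 <= alpha -> 0 <= p ->
  nonneg_coefs k beta -> nonneg_coefs k gamma ->
  nonneg_coefs k delta -> nonneg_coefs k epsilon ->
  is_solution k alpha beta gamma A B C p delta epsilon q D E x y ->
  forall t : int, 1 - k%:Z <= t -> 0 <= x t /\ 0 <= y t.
Proof.
move=> alpha0 p0 beta0 gamma0 delta0 epsilon0 [x0 y0 sol] t ht.
have aff0 (a : R) (b c : nat -> R) (n : nat) :
    0 <= a -> nonneg_coefs k b -> nonneg_coefs k c ->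
    (forall s : int, 1 - k%:Z <= s -> s < n%:Z -> 0 <= x s /\ 0 <= y s) ->
    (1 <= n)%N -> 0 <= affine k a b c x y n.
  move=> a0 b0 c0 xy0 n1; rewrite /affine !addr_ge0 //;
    by apply: sum_index_ge0 => i hi; rewrite mulr_ge0 ?b0 ?c0 //;
       have [||] := xy0 (n%:Z - i%:Z) => //; lia.
have aux n s : 1 - k%:Z <= s -> s <= n%:Z -> 0 <= x s /\ 0 <= y s.
  elim: n s => [|n IH] s sk sn; first by rewrite x0 ?y0 ?sk.
  have [sn'|ns] := leP s n%:Z; first exact: IH.
  have -> : s = n.+1%:Z by lia.
  have IH' r : 1 - k%:Z <= r -> r < n.+1%:Z -> 0 <= x r /\ 0 <= y r.
    by move=> h1 h2; apply: IH => //; lia.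
  have [d1 d2 -> ->] := sol n.+1 isT.
  by rewrite !divr_ge0 ?(ltW d1) ?(ltW d2) ?aff0.
by apply: (aux `|t|%N) => //; lia.
Qed.

Theorem theorem12 (R : realType) (k : nat)
    (alpha : R) (beta gamma : nat -> R) (A : R) (B C : nat -> R)
    (p : R) (delta epsilon : nat -> R) (q : R) (D E : nat -> R)
    (k_pos : (1 <= k)%N)
    (alpha_ge0 : 0 <= alpha) (p_ge0 : 0 <= p)
    (beta_ge0 : nonneg_coefs k beta) (gamma_ge0 : nonneg_coefs k gamma)
    (B_ge0 : nonneg_coefs k B) (C_ge0 : nonneg_coefs k C)
    (delta_ge0 : nonneg_coefs k delta) (epsilon_ge0 : nonneg_coefs k epsilon)
    (D_ge0 : nonneg_coefs k D) (E_ge0 : nonneg_coefs k E)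
    (A_gt0 : 0 < A) (q_gt0 : 0 < q)
    (gamma_sub_C : {subset index_set k gamma <= index_set k C})
    (hB : exists eta : nat, (1 <= eta)%N /\
            block_sums_hit (index_set k beta) (index_set k B) eta)
    (hE : exists eta2 : nat, (1 <= eta2)%N /\
            block_sums_hit (index_set k epsilon) (index_set k E) eta2) :
  exists (M : R) (N : nat),
    [/\ 0 < M, (1 <= N)%N &
      forall x y : int -> R,
        is_solution k alpha beta gamma A B C p delta epsilon q D E x y ->
        forall n : nat, (N < n)%N -> x n%:Z <= M /\ y n%:Z <= M].
Proof.
have [eta [eta1 hitB]] := hB; have [eta2 [_ hitE]] := hE.
(* If [C i = 0] then [gamma i = 0] by [gamma_sub_C], and the summand is 0. *)
pose K1 := alpha / A + \sum_(1 <= i < k.+1) gamma i / C i.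
have K10 : 0 <= K1.
  rewrite addr_ge0 ?divr_ge0 ?(ltW A_gt0) //.
  by apply: sum_index_ge0 => i hi; rewrite divr_ge0 ?gamma_ge0 ?C_ge0.
have [Mx Mx0 x_bound] := recursion_bound K10 A_gt0 beta_ge0 B_ge0 hitB.
pose K2 := (p + \sum_(1 <= i < k.+1) delta i * Mx) / q.
have K20 : 0 <= K2.
  rewrite divr_ge0 ?(ltW q_gt0) // addr_ge0 //.
  by apply: sum_index_ge0 => i hi; rewrite mulr_ge0 ?delta_ge0.
have [My My0 y_bound] := recursion_bound K20 q_gt0 epsilon_ge0 E_ge0 hitE.
(* [x] is bounded from [N1] on; after [k] more indices every lagged [x] in the second equation is
   bounded, and the walk for [y] takes another [k * eta2]. *)
pose N1 := (1 + k * eta)%N; pose N := (N1 + k + k * eta2)%N.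
(* The 1 gives strict positivity, since [Mx] and [My] may vanish. *)
exists (1 + Mx + My), N; split; [lra|by rewrite /N /N1; lia|].
move=> x y sol.
have xy0 := solution_ge0 alpha_ge0 p_ge0 beta_ge0 gamma_ge0 delta_ge0 epsilon_ge0 sol.
have [_ _ rec] := sol.
have x0 s : 1 - k%:Z <= s -> 0 <= x s by case/xy0.
have y0 s : 1 - k%:Z <= s -> 0 <= y s by case/xy0.
have past0 (c : nat -> R) (w : int -> R) n : nonneg_coefs k c ->
    (forall s, 1 - k%:Z <= s -> 0 <= w s) -> (1 <= n)%N ->
    forall i, (1 <= i <= k)%N -> 0 <= c i * w (n%:Z - i%:Z).
  by move=> c0 w0 n1 i hi; rewrite mulr_ge0 ?c0 ?w0 //; clear -n1 hi; lia.
have xM s : N1%:Z <= s -> x s <= Mx.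
  move=> hs; apply: (x_bound x 1) => // {s hs} s hs.
  have [n n1 ->] : exists2 n : nat, (1 <= n)%N & s = n%:Z.
    by exists `|s|%N; clear -hs; lia.
  have [d0 _ -> _] := rec n n1.
  have hBx : 0 <= \sum_(1 <= j < k.+1) B j * x (n%:Z - j%:Z).
    by apply: sum_index_ge0; apply: past0.
  have hCy : 0 <= \sum_(1 <= j < k.+1) C j * y (n%:Z - j%:Z).
    by apply: sum_index_ge0; apply: past0.
  have hbx : 0 <= \sum_(1 <= j < k.+1) beta j * x (n%:Z - j%:Z).
    by apply: sum_index_ge0; apply: past0.
  (* Three quotients are compared: the denominator is lowered to [A] under [alpha], loses its
     [C]-terms under the [beta]-sum, and is lowered to [C i * y (n - i)] against each
     [gamma]-term. *)
  rewrite {1}/affine mulrDl mulrDl /K1 [leRHS]addrAC.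
  apply: lerD; [apply: lerD|].
  - by rewrite ler_wpM2l // lef_pV2 ?posrE // /affine; lra.
  - by rewrite ler_wpM2l // lef_pV2 ?posrE // /affine; lra.
  rewrite mulr_suml; apply: ler_sum_index => i hi.
  have := gamma_ge0 i hi; rewrite le_eqVlt => /orP[/eqP<-|gi]; first by rewrite !mul0r.
  have : i \in index_set k C by apply: gamma_sub_C; rewrite in_index_set hi.
  rewrite in_index_set => /andP[_ Ci].
  rewrite -mulrA ler_wpM2l ?(ltW gi) // ler_pdivrMr // mulrC ler_pdivlMr // mulrC.
  have := @le_term_sum_index _ k (fun i => C i * y (n%:Z - i%:Z)) i.
  by move=> /(_ (past0 _ _ _ C_ge0 y0 n1) hi); rewrite /affine; lra.
have yM s : (N1 + k + k * eta2)%N%:Z <= s -> y s <= My.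
  move=> hs; apply: (y_bound y (N1 + k)%N%:Z) => // {s hs} s hs.
    by apply: y0; rewrite /N1 in hs; clear -hs; lia.
  have [n n1 E'] : exists2 n : nat, (1 <= n)%N & s = n%:Z.
    by exists `|s|%N; rewrite /N1 in hs; clear -hs; lia.
  rewrite {}E' in hs *.
  have [_ d0 _ ->] := rec n n1.
  have hDx : 0 <= \sum_(1 <= j < k.+1) D j * x (n%:Z - j%:Z).
    by apply: sum_index_ge0; apply: past0.
  have hEy : 0 <= \sum_(1 <= j < k.+1) E j * y (n%:Z - j%:Z).
    by apply: sum_index_ge0; apply: past0.
  have hey : 0 <= \sum_(1 <= j < k.+1) epsilon j * y (n%:Z - j%:Z).
    by apply: sum_index_ge0; apply: past0.
  have hdx : 0 <= \sum_(1 <= j < k.+1) delta j * x (n%:Z - j%:Z).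
    by apply: sum_index_ge0; apply: past0.
  have hdM : \sum_(1 <= j < k.+1) delta j * x (n%:Z - j%:Z) <=
             \sum_(1 <= j < k.+1) delta j * Mx.
    by apply: ler_sum_index => i hi; rewrite ler_wpM2l ?delta_ge0 // xM //; clear -hs hi; lia.
  rewrite {1}/affine mulrDl; apply: lerD.
    apply: ler_pM; rewrite ?invr_ge0 ?(ltW d0) ?addr_ge0 ?lerD2l //.
    by rewrite lef_pV2 ?posrE // /affine; lra.
  by rewrite ler_wpM2l // lef_pV2 ?posrE // /affine; lra.
move=> n hn.
have h1 : x n%:Z <= Mx by apply: xM; rewrite /N in hn; clear -hn; lia.
have h2 : y n%:Z <= My by apply: yM; rewrite /N in hn; clear -hn; lia.
by split; lra.
Qed.
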